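(* The generating function $\frac14\sum_{n\ge 3}X_{P_{n,v,w}}z^{n+2}$ of the paths twinned at both leaves has the following $e$-positive expansion: $$\frac14\sum_{n\ge 3}X_{P_{n,v,w}}z^{n+2}=\bigl(K(z)+e_1z\,G(z)\bigr)\frac{G_{\ge 3}(z)^2}{D(z)}+e_1z\,G_{\ge 3}(z)^2+\Bigl(G_{\ge 3}(z)\sum_{i\ge 3}i e_iz^i+e_1z\sum_{i\ge 4}(i-1)e_iz^i+e_2z^2\sum_{i\ge 3}(i-2)e_iz^i\Bigr)+\sum_{i\ge 5}i e_iz^i .$$ In terms of the path generating function $\mathcal{X}_P(z)$, the same series has the $e$-positive expression $$\mathcal{X}_P(z)\,G_{\ge 3}(z)^2+K_{\ge 5}(z)+G_{\ge 3}(z)\sum_{i\ge 3}e_iz^i+e_1z\,G_{\ge 4}(z)+e_2z^2\sum_{i\ge 3}(i-2)e_iz^i .$$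
   Context: The chromatic symmetric function of a finite simple graph $H=(V,E)$ is $X_H=\sum_\kappa\prod_{u\in V}x_{\kappa(u)}$, the sum over all proper colorings $\kappa:V\to\mathbb{Z}_{>0}$. $P_n$ is the path on $n$ vertices ($X_{P_0}=1$). The twin of a graph at a vertex $v$ is obtained by adding a new vertex $v'$ joined to $v$ and to all neighbors of $v$. $P_{n,v,w}$ denotes $P_n$ twinned at its two leaves $v$ and $w$ in succession. $e_i$ is the $i$-th elementary symmetric function; a symmetric function is $e$-positive if its expansion in the elementary basis has nonnegative coefficients, and a power series in $z$ over symmetric functions is $e$-positive if each of its coefficients is. Notation: $\mathcal{X}_P(z)=\sum_{n\ge 0}X_{P_n}z^n$, $K(z)=\sum_{i\ge 2} i e_i z^i$, $K_{\ge k}(z)=\sum_{i\ge k}ie_iz^i$, $G(z)=\sum_{i\ge 2}(i-1)e_iz^i$, $G_{\ge k}(z)=\sum_{i\ge k}(i-1)e_iz^i$, $D(z)=1-G(z)$. *)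

(* Defs.v *)
From HB Require Import structures.
From mathcomp Require Import all_boot all_order all_algebra.
From mathcomp Require Import finmap multiset.
From mathcomp Require Import boolp.

Set Implicit Arguments.
Unset Strict Implicit.
Unset Printing Implicit Defensive.

Import Order.TTheory GRing.Theory Num.Theory.
Local Open Scope ring_scope.

(* A monomial in the variables x_0, x_1, ... is a finite multiset of variable
   indices.  Indices start at 0: the index i stands for the variable x_(i+1)
   (and, below, for the colour i+1), so that nat plays the role of Z_{>0}. *)
Notation monomial := ({mset nat}%mset).

Definition mdivisors (m : monomial) : seq monomial :=
  undup [seq seq_mset (mask b m) | b : (size m).-tuple bool].

Lemma mem_mdivisors (m d : monomial) : (d \in mdivisors m) = msubset d m.
Proof.
rewrite /mdivisors mem_undup; apply/mapP/msubsetP => [[b _ ->] x|le_dm].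
  rewrite mset_seqE -[leqRHS]count_mem_mset; apply: leq_count_subseq.
  exact: mask_subseq.
have /count_subseqP[s /subseqP[b sz_b ->] eq_ds] x :
    (count_mem x d <= count_mem x m)%N by rewrite !count_mem_mset.
exists (tcast sz_b (in_tuple b)); first by rewrite mem_enum.
rewrite val_tcast /= -[LHS]seq_mset_id; exact/eq_seq_msetP.
Qed.

Lemma mdivisors_uniq m : uniq (mdivisors m).
Proof. exact: undup_uniq. Qed.

(* The ring rat[[x_1, x_2, ...]]; xcoef f m is the coefficient of m in f. *)
Record xseries := XSeries { xcoef :> monomial -> rat }.

Lemma xseriesP (f g : xseries) : f =1 g -> f = g.
Proof. by case: f g => f [g] /= /funext->. Qed.

HB.instance Definition _ := gen_eqMixin xseries.
HB.instance Definition _ := gen_choiceMixin xseries.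

Definition xzero := XSeries (fun=> 0).
Definition xopp (f : xseries) := XSeries (fun m => - f m).
Definition xadd (f g : xseries) := XSeries (fun m => f m + g m).
Definition xone := XSeries (fun m => (m == mset0)%:R).
Definition xmul (f g : xseries) :=
  XSeries (fun m => \sum_(d <- mdivisors m) f d * g (msetB m d)).
Definition xscale (c : rat) (f : xseries) := XSeries (fun m => c * f m).

Fact xaddA : associative xadd.
Proof. by move=> f g h; apply: xseriesP => m /=; rewrite addrA. Qed.
Fact xaddC : commutative xadd.
Proof. by move=> f g; apply: xseriesP => m /=; rewrite addrC. Qed.
Fact xadd0 : left_id xzero xadd.
Proof. by move=> f; apply: xseriesP => m /=; rewrite add0r. Qed.
Fact xaddN : left_inverse xzero xopp xadd.
Proof. by move=> f; apply: xseriesP => m /=; rewrite addNr. Qed.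

HB.instance Definition _ :=
  GRing.isZmodule.Build xseries xaddA xaddC xadd0 xaddN.

Lemma msetBB_sub (m d c : monomial) : msubset c d -> msubset d m ->
  msetB (msetB m c) (msetB d c) = msetB m d.
Proof.
move=> /msubsetP cd /msubsetP dm; apply/msetP => x; rewrite !msetE2.
by rewrite subnBA // subnK // (leq_trans (cd x)).
Qed.

Fact xmulC : commutative xmul.
Proof.
move=> f g; apply: xseriesP => m /=.
have -> : \sum_(d <- mdivisors m) f d * g (msetB m d) =
    \sum_(d <- [seq msetB m d | d <- mdivisors m]) f d * g (msetB m d).
  apply: perm_big; apply: uniq_perm; first exact: mdivisors_uniq.
    rewrite map_inj_in_uniq ?mdivisors_uniq // => c d.
    rewrite !mem_mdivisors => cm dm eq_cd.
    by rewrite -(msetBBK cm) eq_cd msetBBK.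
  move=> d; rewrite mem_mdivisors; apply/idP/mapP => [dm|[c _ ->]].
    by exists (msetB m d); rewrite ?mem_mdivisors ?msubsetDl // msetBBK.
  exact: msubsetDl.
rewrite big_map; apply: eq_big_seq => d; rewrite mem_mdivisors => dm.
by rewrite mulrC msetBBK.
Qed.

Fact xmulA : associative xmul.
Proof.
move=> f g h; apply: xseriesP => m /=.
pose F (p : monomial * monomial) :=
  f p.1 * g (msetB p.2 p.1) * h (msetB m p.2).
transitivity (\sum_(p <- [seq (c, msetD c b) | c <- mdivisors m,
                              b <- mdivisors (msetB m c)]) F p).
  rewrite big_allpairs_dep /=; apply: eq_big_seq => c _.
  rewrite mulr_sumr; apply: eq_bigr => b _.
  by rewrite /F /= mulrA msetDKB msetBDA.
transitivity (\sum_(p <- [seq (c, d) | d <- mdivisors m, c <- mdivisors d]) F p).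
  apply: perm_big; apply: uniq_perm.
  - apply: allpairs_uniq_dep => [||[c b] [c' b'] _ _ /= [<-]].
    + exact: mdivisors_uniq.
    + by move=> c _; apply: mdivisors_uniq.
    + by move=> /(can_inj (msetDKB c)) <-.
  - apply: allpairs_uniq_dep => [||[c b] [c' b'] _ _ /= [-> ->]] //.
    + exact: mdivisors_uniq.
    + by move=> c _; apply: mdivisors_uniq.
  move=> [c d]; apply/allpairsPdep/allpairsPdep => [[c' [b [c'm bm [-> ->]]]]|].
    exists (msetD c' b), c'; split=> //.
      move: c'm bm; rewrite !mem_mdivisors => c'm bm.
      by rewrite -(msetBDKC c'm) msetDS.
    rewrite mem_mdivisors; apply/msubsetP => x.
    by rewrite msetE2 leq_addr.
  move=> [d' [c' [d'm c'd' [-> ->]]]]; move: d'm c'd'.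
  rewrite !mem_mdivisors => dm cd.
  exists c', (msetB d' c'); split.
  - by rewrite mem_mdivisors (msubset_trans cd).
  - by rewrite mem_mdivisors msetSB.
  - by rewrite msetBDKC.
rewrite big_allpairs_dep /=; apply: eq_big_seq => d.
by rewrite mem_mdivisors => dm; rewrite mulr_suml.
Qed.

Fact xmul1 : left_id xone xmul.
Proof.
move=> f; apply: xseriesP => m /=.
rewrite (bigD1_seq mset0) ?mdivisors_uniq //=; last first.
  by rewrite mem_mdivisors msub0set.
rewrite eqxx mul1r msetB0 big1 ?addr0 // => d /negPf->.
by rewrite mul0r.
Qed.

Fact xmulDl : left_distributive xmul xadd.
Proof.
move=> f g h; apply: xseriesP => m /=; rewrite -big_split /=.
by apply: eq_bigr => d _; rewrite mulrDl.
Qed.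

Fact xone_neq0 : xone != 0.
Proof.
by apply/eqP => /(congr1 (fun f => xcoef f mset0)) /=; rewrite eqxx.
Qed.

HB.instance Definition _ :=
  GRing.Zmodule_isComNzRing.Build xseries xmulA xmulC xmul1 xmulDl xone_neq0.

Fact xscaleA a b f : xscale a (xscale b f) = xscale (a * b) f.
Proof. by apply: xseriesP => m /=; rewrite mulrA. Qed.
Fact xscale1 : left_id 1 xscale.
Proof. by move=> f; apply: xseriesP => m /=; rewrite mul1r. Qed.
Fact xscaleDr : right_distributive xscale +%R.
Proof. by move=> a f g; apply: xseriesP => m /=; rewrite mulrDr. Qed.
Fact xscaleDl f : {morph xscale^~ f : a b / a + b}.
Proof. by move=> a b; apply: xseriesP => m /=; rewrite mulrDl. Qed.

HB.instance Definition _ :=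
  GRing.Zmodule_isLmodule.Build rat xseries
    xscaleA xscale1 xscaleDr xscaleDl.

Fact xscaleAl (a : rat) (f g : xseries) : a *: (f * g) = a *: f * g.
Proof.
apply: xseriesP => m /=; rewrite mulr_sumr.
by apply: eq_bigr => d _; rewrite mulrA.
Qed.

HB.instance Definition _ := GRing.Lmodule_isLalgebra.Build rat xseries xscaleAl.
HB.instance Definition _ := GRing.Lalgebra_isComAlgebra.Build rat xseries.

(* The elementary symmetric function e_k: its monomials are the squarefree
   monomials of degree k. *)
Definition elem_sym (k : nat) : xseries :=
  XSeries (fun m => (uniq m && (size m == k))%:R).

Definition is_partition (l : seq nat) := sorted geq l && (0%N \notin l).

Definition elem_sym_part (l : seq nat) : xseries := \prod_(i <- l) elem_sym i.

Definition e_positive (f : xseries) : Prop :=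
  exists (L : seq (seq nat)) (c : seq nat -> rat),
    [/\ uniq L, all is_partition L, forall l, 0 <= c l
      & f = \sum_(l <- L) c l *: elem_sym_part l].

(* The ring A[[z]]; zcoef f n is the coefficient of z^n in f. *)
Record zseries (A : Type) := ZSeries { zcoef :> nat -> A }.

Section ZSeries.

Lemma zseriesP A (f g : zseries A) : f =1 g -> f = g.
Proof. by case: f g => f [g] /= /funext->. Qed.

HB.instance Definition _ A := gen_eqMixin (zseries A).
HB.instance Definition _ A := gen_choiceMixin (zseries A).

Section Zmodule.
Variable A : zmodType.
Implicit Types f g : zseries A.

Definition zzero : zseries A := ZSeries (fun=> 0).
Definition zopp f := ZSeries (fun n => - f n).
Definition zadd f g := ZSeries (fun n => f n + g n).

Fact zaddA : associative zadd.
Proof. by move=> f g h; apply: zseriesP => n /=; rewrite addrA. Qed.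
Fact zaddC : commutative zadd.
Proof. by move=> f g; apply: zseriesP => n /=; rewrite addrC. Qed.
Fact zadd0 : left_id zzero zadd.
Proof. by move=> f; apply: zseriesP => n /=; rewrite add0r. Qed.
Fact zaddN : left_inverse zzero zopp zadd.
Proof. by move=> f; apply: zseriesP => n /=; rewrite addNr. Qed.

HB.instance Definition _ :=
  GRing.isZmodule.Build (zseries A) zaddA zaddC zadd0 zaddN.
End Zmodule.

Section Lmodule.
Variables (R : nzRingType) (A : lmodType R).
Implicit Types f g : zseries A.

Definition zscale (c : R) f := ZSeries (fun n => c *: f n).

Fact zscaleA a b f : zscale a (zscale b f) = zscale (a * b) f.
Proof. by apply: zseriesP => n /=; rewrite scalerA. Qed.
Fact zscale1 : left_id 1 zscale.
Proof. by move=> f; apply: zseriesP => n /=; rewrite scale1r. Qed.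
Fact zscaleDr : right_distributive zscale +%R.
Proof. by move=> a f g; apply: zseriesP => n /=; rewrite scalerDr. Qed.
Fact zscaleDl f : {morph zscale^~ f : a b / a + b}.
Proof. by move=> a b; apply: zseriesP => n /=; rewrite scalerDl. Qed.

HB.instance Definition _ :=
  GRing.Zmodule_isLmodule.Build R (zseries A)
    zscaleA zscale1 zscaleDr zscaleDl.
End Lmodule.

Section Ring.
Variable A : comNzRingType.
Implicit Types f g : zseries A.

Definition zconst (a : A) : zseries A :=
  ZSeries (fun n => if n == 0%N then a else 0).
Definition zvar : zseries A := ZSeries (fun n => (n == 1%N)%:R).
Definition zmul f g :=
  ZSeries (fun n => \sum_(i < n.+1) f i * g (n - i)%N).

Definition ztrunc N f : {poly A} := \poly_(i < N) f i.

Lemma zmul_trunc N f g n : (n < N)%N ->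
  zmul f g n = (ztrunc N f * ztrunc N g)`_n.
Proof.
move=> nN; rewrite coefM; apply: eq_bigr => i _; rewrite !coef_poly.
by rewrite !ifT // (leq_ltn_trans _ nN) ?leq_subr // -ltnS.
Qed.

Fact zmulC : commutative zmul.
Proof.
by move=> f g; apply: zseriesP => n; rewrite !(@zmul_trunc n.+1) // mulrC.
Qed.

Fact zmulA : associative zmul.
Proof.
move=> f g h; apply: zseriesP => n.
transitivity ((ztrunc n.+1 f * (ztrunc n.+1 g * ztrunc n.+1 h))`_n).
  rewrite coefM; apply: eq_bigr => i _; rewrite coef_poly ltn_ord.
  by rewrite (@zmul_trunc n.+1) // ltnS leq_subr.
rewrite mulrA coefM; apply: eq_bigr => i _.
by rewrite (@zmul_trunc n.+1) // coef_poly ltnS leq_subr.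
Qed.

Fact zmul1 : left_id (zconst 1) zmul.
Proof.
move=> f; apply: zseriesP => n /=; rewrite big_ord_recl /= mul1r subn0.
by rewrite big1 ?addr0 // => i _; rewrite mul0r.
Qed.

Fact zmulDl : left_distributive zmul (@zadd A).
Proof.
move=> f g h; apply: zseriesP => n /=; rewrite -big_split /=.
by apply: eq_bigr => i _; rewrite mulrDl.
Qed.

Fact zone_neq0 : zconst 1 != 0.
Proof.
by apply/eqP => /(congr1 (fun f => zcoef f 0%N)) /= /eqP; rewrite oner_eq0.
Qed.

HB.instance Definition _ :=
  GRing.Zmodule_isComNzRing.Build (zseries A)
    zmulA zmulC zmul1 zmulDl zone_neq0.

Definition zunit f : bool := `[< exists g, g * f = 1 >].
Definition zinv f : zseries A :=
  if pselect (exists g, g * f = 1) is left ex then projT1 (cid ex) else f.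

Fact zmulV : {in zunit, left_inverse 1 zinv *%R}.
Proof.
move=> f /asboolP uf; rewrite /zinv; case: pselect => // ex.
exact: projT2 (cid ex).
Qed.
Fact zunitP f g : g * f = 1 -> zunit f.
Proof. by move=> gf1; apply/asboolP; exists g. Qed.
Fact zinv_out : {in [predC zunit], zinv =1 id}.
Proof.
by move=> f /asboolP nuf; rewrite /zinv; case: pselect.
Qed.

HB.instance Definition _ :=
  GRing.ComNzRing_hasMulInverse.Build (zseries A) zmulV zunitP zinv_out.

(* The coefficients h_0, ..., h_n of the inverse h of a series f with
   constant coefficient 1. *)
Fixpoint zinv_prefix f n : seq A :=
  if n is n'.+1 then
    let s := zinv_prefix f n' in
    rcons s (- \sum_(i < n'.+1) f i.+1 * s`_(n' - i))
  else [:: 1].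

Lemma zunit1 f : f 0%N = 1 -> f \is a GRing.unit.
Proof.
move=> f0; pose h := ZSeries (fun n => (zinv_prefix f n)`_n).
have szp n : size (zinv_prefix f n) = n.+1.
  by elim: n => //= n IHn; rewrite size_rcons IHn.
have nthp n k : (k <= n)%N -> (zinv_prefix f n)`_k = h k.
  elim: n => [|n IHn]; first by rewrite leqn0 => /eqP->.
  rewrite leq_eqVlt => /predU1P[-> //|kn] /=.
  by rewrite nth_rcons szp kn IHn.
apply: (@zunitP f h); rewrite mulrC; apply: zseriesP => -[|n].
  by rewrite /= big_ord1 /= f0 mul1r.
rewrite /= big_ord_recl /= f0 mul1r subn0.
rewrite nth_rcons szp ltnn eqxx; apply/eqP; rewrite addrC subr_eq0; apply/eqP.
by apply: eq_bigr => i _; rewrite /bump /= add1n subSS [in RHS]nthp ?leq_subr.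
Qed.

End Ring.
End ZSeries.

(* zsum m d a is the series \sum_(n >= m) a_n z^(n + d). *)
Definition zsum (m d : nat) (a : nat -> xseries) : zseries xseries :=
  ZSeries (fun k => if (m + d <= k)%N then a (k - d)%N else 0).

Definition e_positive_series (f : zseries xseries) : Prop :=
  forall n, e_positive (f n).

Record sgraph := SGraph {
  vertex :> finType;
  adj : rel vertex;
  adj_sym : symmetric adj;
  adj_irr : irreflexive adj }.

(* The coefficient of the monomial m in X_H is the number of proper colourings
   whose monomial is m; such a colouring only uses colours occurring in m, so
   it is a function into the finite support of m. *)
Definition chromatic_sym (H : sgraph) : xseries :=
  XSeries (fun m =>
    #|[set kappa : {ffun H -> finsupp m} |
        [forall u, forall w, adj u w ==> (kappa u != kappa w)] &&
        (seq_mset [seq val (kappa u) | u <- enum H] == m)]|%:R).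

Section PathGraph.
Variable n : nat.

Definition path_adj : rel 'I_n := fun i j =>
  (j == i.+1 :> nat) || (i == j.+1 :> nat).

Fact path_adj_sym : symmetric path_adj.
Proof. by move=> i j; rewrite /path_adj orbC. Qed.
Fact path_adj_irr : irreflexive path_adj.
Proof. by move=> i; rewrite /path_adj orbb; apply/eqP/n_Sn. Qed.

Definition path_graph : sgraph := SGraph path_adj_sym path_adj_irr.
End PathGraph.

(* In twin H v, the new vertex v' is None. *)
Section Twin.
Variables (H : sgraph) (v : H).

Definition twin_adj : rel (option H) := fun a b =>
  match a, b with
  | Some u, Some w => adj u w
  | Some u, None | None, Some u => (u == v) || adj v u
  | None, None => false
  end.

Fact twin_adj_sym : symmetric twin_adj.
Proof. by move=> [u|] [w|] //=; apply: adj_sym. Qed.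
Fact twin_adj_irr : irreflexive twin_adj.
Proof. by move=> [u|] //=; apply: adj_irr. Qed.

Definition twin : sgraph := SGraph twin_adj_sym twin_adj_irr.
End Twin.

(* P_{n,v,w}: P_n twinned at its leaf v = 0 and then at its leaf w = n - 1.
   Only used for n >= 3; the value at n = 0 is irrelevant. *)
Definition twinned_path (n : nat) : sgraph :=
  if n is n'.+1 then
    @twin (@twin (path_graph n'.+1) (ord0 : 'I_n'.+1)) (Some (ord_max : 'I_n'.+1))
  else path_graph 0.

Definition XP : zseries xseries :=
  zsum 0 0 (fun n => chromatic_sym (path_graph n)).

Definition K_ge (k : nat) : zseries xseries := zsum k 0 (fun i => elem_sym i *+ i).
Definition G_ge (k : nat) : zseries xseries :=
  zsum k 0 (fun i => elem_sym i *+ (i - 1)).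

Definition Kz := K_ge 2.
Definition Gz := G_ge 2.
Definition Dz : zseries xseries := 1 - Gz.

Lemma Dz_unit : Dz \is a GRing.unit.
Proof. by apply: zunit1; rewrite /Dz /= subr0. Qed.

(* Main.v *)
(* A coloring of the n-th twinned path is a proper word on its inner n - 2
   vertices, weighted at the first and last letters a and b by 2 f_a and 2 f_b,
   where f_a = z^2 e_2 - z^2 e_1 x_a + z^2 x_a^2 is z^2 times e_2 of the
   variables other than x_a.  Put t_a = x_a z and u_a = t_a / (1 + t_a).
   Solving the linear recursion on the first letter gives
     X_P (1 - sum_a u_a) = 1  and  S = sum_a u_a f_a^2 + X_P (sum_a u_a f_a)^2.
   Dividing f_a and f_a^2 by 1 + t_a turns both sums into power sums of degree
   at most 4 plus multiples of U = sum_a u_a.  Since E (1 - U) = E - z E' = D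
   for E = prod_a (1 + t_a), the terms in U combine into X_P (1 - e_2 z^2)^2
   and a polynomial in e_1 z, ..., e_4 z^4; expanding
   X_P G_{>=3}^2 = X_P (1 - e_2 z^2 - D)^2 with X_P D = E yields the formulas.
   Sums over letters are finite after setting all but N variables to 0, a ring
   morphism; an identity of series may be checked for every N. *)
From HB Require Import structures.
Require Import Defs.
From mathcomp Require Import all_boot all_order all_algebra.
From mathcomp Require Import finmap multiset ring.

Set Implicit Arguments.
Unset Strict Implicit.
Unset Printing Implicit Defensive.

Import GRing.Theory Num.Theory.
Local Open Scope ring_scope.

(** * Ring identities behind the sums over letters *)

Section Algebra.
Variables (Z : comNzRingType) (I : finType).

(** Restoring the missing term [b = a] in the recursion gives [(1 + t a) * W a = t a * (w a + SW)],
    hence [W a = u a * (w a + SW)]; summing over [a] determines [SW]. Here [W a] models the words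
    starting with [a], and [w] is the mark carried by an end letter. *)
Lemma marked_words_total (t u w W : I -> Z) (X : Z) :
    (forall a, u a * (1 + t a) = t a) ->
    (forall a, W a = t a * (w a + \sum_(b | b != a) W b)) ->
    X * (1 - \sum_a u a) = 1 ->
  \sum_a w a * W a = \sum_a u a * w a ^+ 2 + X * (\sum_a u a * w a) ^+ 2.
Proof.
move=> uE WE XU.
pose SW := \sum_a W a.
have Wa a : W a = u a * (w a + SW).
  have : (1 + t a) * W a = t a * (w a + SW).
    by rewrite mulrDl mul1r {1}WE /SW [in RHS](bigD1 a) //=; ring.
  (* [1 - u a] is the inverse of [1 + t a]. *)
  move/(congr1 (fun y => (1 - u a) * y)).
  have t1 : (1 - u a) * (1 + t a) = 1 by rewrite mulrBl uE; ring.
  have t2 : (1 - u a) * t a = u a by rewrite mulrBl -{1}(uE a); ring.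
  by rewrite !mulrA t1 t2 mul1r.
have SWE : SW = X * \sum_a u a * w a.
  have : SW * (1 - \sum_a u a) = \sum_a u a * w a.
    rewrite mulrBr mulr1 {1}/SW (eq_bigr _ (fun a _ => Wa a)).
    rewrite (eq_bigr (fun a => u a * w a + u a * SW)) => [|a _]; last by ring.
    by rewrite big_split /= -mulr_suml; ring.
  by move/(congr1 (fun y => X * y)); rewrite mulrCA XU mulr1.
transitivity (\sum_a (u a * w a ^+ 2 + u a * w a * SW)).
  by apply: eq_bigr => a _; rewrite Wa; ring.
by rewrite big_split /= -mulr_suml SWE; ring.
Qed.

(** As polynomials in [t a], [f a] and its square leave the remainders [F] and [F ^+ 2] on division
    by [1 + t a], where [F = 1 + E1 + E2] is the value at -1. The quotients contribute power sums,
    the remainders multiples of the sum of the [u a]. *)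
Lemma twin_quotient_sums (t u : I -> Z) (E1 E2 E3 E4 X : Z) :
    (forall a, u a * (1 + t a) = t a) ->
    \sum_a t a = E1 -> \sum_a t a ^+ 2 = E1 ^+ 2 - E2 *+ 2 ->
    \sum_a t a ^+ 3 = E1 ^+ 3 - E1 * E2 *+ 3 + E3 *+ 3 ->
    \sum_a t a ^+ 4
      = E1 ^+ 4 - E1 ^+ 2 * E2 *+ 4 + E2 ^+ 2 *+ 2 + E1 * E3 *+ 4 - E4 *+ 4 ->
    X * (1 - \sum_a u a) = 1 ->
  let f a := E2 - E1 * t a + t a ^+ 2 in
  \sum_a u a * f a ^+ 2 + X * (\sum_a u a * f a) ^+ 2
    = X * (1 - E2) ^+ 2 - (1 - E2) * (1 + E1 + E2) + (1 - E2) * (E1 + E2)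
      + E2 * (1 + E1 + E2) - E1 - E2 *+ 2 - E1 * E3 *+ 2 - E3 *+ 3 - E4 *+ 4.
Proof.
move=> uE p1 p2 p3 p4 XU f.
set U := \sum_a u a in XU *; set F := 1 + E1 + E2.
have ufE a : u a * f a = t a ^+ 2 - t a * (1 + E1) + F * u a.
  have -> : f a = (1 + t a) * (t a - 1 - E1) + F by rewrite /f /F; ring.
  by rewrite mulrDr mulrA uE; ring.
have S1 : \sum_a u a * f a = 1 - E2 - F * (1 - U).
  rewrite (eq_bigr _ (fun a _ => ufE a)) big_split /= -mulr_sumr -/U.
  by rewrite big_split /= sumrN -mulr_suml p1 p2 /F; ring.
(* the coefficients are those of the quotient of [f ^ 2] by [1 + t] *)
have uf2E a : u a * f a ^+ 2 = t a ^+ 4 - t a ^+ 3 * (E1 *+ 2 + 1)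
    + t a ^+ 2 * (E2 *+ 2 + E1 ^+ 2 + E1 *+ 2 + 1)
    - t a * (E1 * E2 *+ 2 + E2 *+ 2 + E1 ^+ 2 + E1 *+ 2 + 1)
    + F ^+ 2 * u a.
  have -> : f a ^+ 2 = (1 + t a) * (t a ^+ 3 - t a ^+ 2 * (E1 *+ 2 + 1)
     + t a * (E2 *+ 2 + E1 ^+ 2 + E1 *+ 2 + 1)
     - (E1 * E2 *+ 2 + E2 *+ 2 + E1 ^+ 2 + E1 *+ 2 + 1)) + F ^+ 2.
    by rewrite /f /F; ring.
  by rewrite mulrDr mulrA uE; ring.
have S2 : \sum_a u a * f a ^+ 2 = - F ^+ 2 + (1 - E2) * F
      + (1 - E2) * (E1 + E2)
      + E2 * F - E1 - E2 *+ 2 - E1 * E3 *+ 2 - E3 *+ 3 - E4 *+ 4 + F ^+ 2 * U.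
  rewrite (eq_bigr _ (fun a _ => uf2E a)) big_split /= -mulr_sumr -/U.
  rewrite big_split /= big_split /= big_split /= !sumrN -!mulr_suml p1 p2 p3 p4.
  by rewrite /F; ring.
rewrite S1 S2.
(* Each factor [X * (1 - U)] becomes 1 by [XU]; the surviving [F ^+ 2 * (1 - U)] then cancels
   [- F ^+ 2 + F ^+ 2 * U]. *)
transitivity (X * (1 - E2) ^+ 2 - (1 - E2) * F * (X * (1 - U)) *+ 2
  + F ^+ 2 * ((X * (1 - U)) * (1 - U))
  + (- F ^+ 2 + (1 - E2) * F
      + (1 - E2) * (E1 + E2)
      + E2 * F - E1 - E2 *+ 2 - E1 * E3 *+ 2 - E3 *+ 3 - E4 *+ 4 + F ^+ 2 * U)).
  by ring.
by rewrite XU; ring.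
Qed.

(** With [theta] for z E', the groups on the right are, in order, the forms of X_P G_{>=3}^2,
    K_{>=5}, G_{>=3} times the e_i with i >= 3, e_1 z G_{>=4}, and e_2 z^2 times the sum of the
    (i-2) e_i z^i. *)
Lemma twin_form_collect (X E theta E1 E2 E3 E4 : Z) :
  let D := E - theta in
  X * D = E ->
  let G3 := 1 - E2 - D in
  let E_3 := E - 1 - E1 - E2 in
  X * (1 - E2) ^+ 2 - (1 - E2) * (1 + E1 + E2) + (1 - E2) * (E1 + E2)
      + E2 * (1 + E1 + E2) - E1 - E2 *+ 2 - E1 * E3 *+ 2 - E3 *+ 3 - E4 *+ 4
  = X * G3 ^+ 2 + (theta - E1 - E2 *+ 2 - E3 *+ 3 - E4 *+ 4) + G3 * E_3
    + E1 * (G3 - E3 *+ 2) + E2 * (G3 - E_3).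
Proof.
move=> D XD G3 E_3.
have -> : X * G3 ^+ 2
    = X * (1 - E2) ^+ 2 - (1 - E2) * (X * D) *+ 2 + (X * D) * D.
  by rewrite /G3; ring.
by rewrite XD /E_3 /G3 /D; ring.
Qed.

End Algebra.

(** * Power series in z *)

Section ZSeriesTheory.
Variable R : comNzRingType.
Implicit Types (f g : zseries R) (c : R).

Lemma zcoefD f g n : (f + g) n = f n + g n. Proof. by []. Qed.

Lemma zcoefB f g n : (f - g) n = f n - g n. Proof. by []. Qed.

Lemma zcoef1 n : (1 : zseries R) n = (n == 0%N)%:R.
Proof. by rewrite /=; case: eqP. Qed.

Lemma zcoefMn f k n : (f *+ k) n = f n *+ k.
Proof. by elim: k => [|k IHk] //; rewrite !mulrS zcoefD IHk. Qed.

Lemma zcoef_sum (I : Type) (r : seq I) (P : pred I) (F : I -> zseries R) n :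
  (\sum_(i <- r | P i) F i) n = \sum_(i <- r | P i) F i n.
Proof. by elim/big_rec2: _ => // i y1 y2 _ <-. Qed.

Lemma zcoef_constM c f n : (zconst c * f) n = c * f n.
Proof.
rewrite /= big_ord_recl /= subn0 big1 ?addr0 // => i _.
by rewrite mul0r.
Qed.

Lemma zcoef_varM f n : (zvar R * f) n = if n is k.+1 then f k else 0.
Proof.
rewrite /=; case: n => [|n]; first by rewrite big_ord1 mul0r.
rewrite 2!big_ord_recl /= mul0r add0r mul1r subSS subn0.
by rewrite big1 ?addr0 // => i _; rewrite mul0r.
Qed.

Lemma zcoef_varXM k f n :
  (zvar R ^+ k * f) n = if (k <= n)%N then f (n - k)%N else 0.
Proof.
elim: k n => [|k IHk] n; first by rewrite expr0 mul1r subn0.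
by rewrite exprS -mulrA zcoef_varM; case: n => [|n] //; rewrite IHk.
Qed.

Lemma zcoef_monom c k n : (zconst c * zvar R ^+ k) n = c *+ (n == k).
Proof.
rewrite zcoef_constM -[zvar R ^+ k]mulr1 zcoef_varXM zcoef1.
rewrite subn_eq0 eqn_leq; case: (leqP k n) => _; last by rewrite andbF mulr0.
by rewrite andbT mulr_natr.
Qed.

Lemma zconstM c d : zconst (c * d) = zconst c * zconst d :> zseries R.
Proof.
by apply: zseriesP => n; rewrite zcoef_constM /=; case: eqP; rewrite ?mulr0.
Qed.

Lemma zconstD c d : zconst (c + d) = zconst c + zconst d :> zseries R.
Proof. by apply: zseriesP => n /=; case: eqP; rewrite ?addr0. Qed.

Lemma zconstB c d : zconst (c - d) = zconst c - zconst d :> zseries R.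
Proof. by apply: zseriesP => n /=; case: eqP; rewrite ?subr0. Qed.

Lemma zconstX c k : zconst (c ^+ k) = zconst c ^+ k :> zseries R.
Proof. by elim: k => [|k IHk] //; rewrite !exprS zconstM IHk. Qed.

Lemma zconstMn c k : zconst (c *+ k) = zconst c *+ k :> zseries R.
Proof.
by apply: zseriesP => n; rewrite zcoefMn /=; case: eqP; rewrite ?mul0rn.
Qed.

Lemma zconst_sum (I : Type) (r : seq I) (F : I -> R) :
  zconst (\sum_(i <- r) F i) = \sum_(i <- r) zconst (F i) :> zseries R.
Proof.
elim: r => [|i r IHr]; rewrite ?big_nil ?big_cons ?zconstD ?IHr //.
by apply: zseriesP => n /=; case: eqP.
Qed.

(* The derivation z d/dz. *)
Definition ztheta f : zseries R := ZSeries (fun n => f n *+ n).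

Lemma zcoef_theta f n : ztheta f n = f n *+ n. Proof. by []. Qed.

Lemma zthetaM f g : ztheta (f * g) = ztheta f * g + f * ztheta g.
Proof.
apply: zseriesP => n; rewrite /= -sumrMnl -big_split /=.
apply: eq_bigr => i _.
by rewrite mulrnAl mulrnAr -mulrnDr subnKC // -ltnS.
Qed.

End ZSeriesTheory.

(** * The product of the factors 1 + x_a z, its logarithmic derivative and Newton's identities *)

Section ElementaryProduct.
Variables (R : comNzRingType) (I : Type) (x : I -> R).
Implicit Types r : seq I.

(** [zlin a], [elem_prod r] and [zlin_quot a] are t_a, E and u_a. The letters form a list so that
    proofs can add one variable at a time. *)
Definition zlin (a : I) : zseries R := zconst (x a) * zvar R.

Definition elem_prod r : zseries R := \prod_(a <- r) (1 + zlin a).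

Definition zlin_quot (a : I) : zseries R := zlin a / (1 + zlin a).

Lemma zlin_quotK a : zlin_quot a * (1 + zlin a) = zlin a.
Proof.
rewrite /zlin_quot divrK //; apply: zunit1.
by rewrite zcoefD /zlin zcoef_constM /= mulr0 addr0.
Qed.

Lemma elem_prod_nil n : elem_prod [::] n = (n == 0%N)%:R.
Proof. by rewrite /elem_prod big_nil zcoef1. Qed.

Lemma elem_prod_cons0 a r : elem_prod (a :: r) 0%N = elem_prod r 0%N.
Proof.
rewrite /elem_prod big_cons mulrDl mul1r zcoefD -mulrA zcoef_constM.
by rewrite zcoef_varM mulr0 addr0.
Qed.

Lemma elem_prod_consS a r n :
  elem_prod (a :: r) n.+1 = elem_prod r n.+1 + x a * elem_prod r n.
Proof.
rewrite /elem_prod big_cons mulrDl mul1r zcoefD -mulrA zcoef_constM.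
by rewrite zcoef_varM.
Qed.

Lemma elem_prod0 r : elem_prod r 0%N = 1.
Proof.
by elim: r => [|a r IHr]; rewrite ?elem_prod_nil ?elem_prod_cons0.
Qed.

(** Logarithmic derivative: z d/dz maps the factor 1 + t_a to t_a, which is u_a times that
    factor. *)
Lemma elem_prod_theta r :
  ztheta (elem_prod r) = elem_prod r * \sum_(a <- r) zlin_quot a.
Proof.
elim: r => [|a r IHr].
  rewrite big_nil mulr0; apply: zseriesP => n.
  by rewrite /= elem_prod_nil; case: n => [|n] //=; rewrite mul0rn.
have -> : elem_prod (a :: r) = (1 + zlin a) * elem_prod r.
  by rewrite /elem_prod big_cons.
rewrite zthetaM IHr big_cons.
have -> : ztheta (1 + zlin a) = zlin a.
  apply: zseriesP => n; rewrite zcoef_theta zcoefD zcoef1 /zlin.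
  rewrite zcoef_constM /=.
  by case: n => [|[|n]]; rewrite ?mulr0n ?mulr0 ?add0r ?mul0rn ?mulr1n ?add0r.
rewrite -{1}(zlin_quotK a); ring.
Qed.

(** A new letter changes e_k into e_k + x_a e_{k-1}, so this and the next three power sums follow by
    induction on the list. *)
Lemma newton1 r : \sum_(a <- r) x a = elem_prod r 1%N.
Proof.
elim: r => [|a r IHr]; first by rewrite big_nil elem_prod_nil.
by rewrite big_cons elem_prod_consS elem_prod0 IHr; ring.
Qed.

Lemma newton2 r :
  \sum_(a <- r) x a ^+ 2 = elem_prod r 1%N ^+ 2 - elem_prod r 2%N *+ 2.
Proof.
elim: r => [|a r IHr]; first by rewrite big_nil !elem_prod_nil /=; ring.
by rewrite big_cons !elem_prod_consS elem_prod0 IHr; ring.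
Qed.

Lemma newton3 r :
  \sum_(a <- r) x a ^+ 3 = elem_prod r 1%N ^+ 3
    - elem_prod r 1%N * elem_prod r 2%N *+ 3 + elem_prod r 3%N *+ 3.
Proof.
elim: r => [|a r IHr]; first by rewrite big_nil !elem_prod_nil /=; ring.
by rewrite big_cons !elem_prod_consS elem_prod0 IHr; ring.
Qed.

Lemma newton4 r :
  \sum_(a <- r) x a ^+ 4 = elem_prod r 1%N ^+ 4
    - elem_prod r 1%N ^+ 2 * elem_prod r 2%N *+ 4 + elem_prod r 2%N ^+ 2 *+ 2
    + elem_prod r 1%N * elem_prod r 3%N *+ 4 - elem_prod r 4%N *+ 4.
Proof.
elim: r => [|a r IHr]; first by rewrite big_nil !elem_prod_nil /=; ring.
by rewrite big_cons !elem_prod_consS elem_prod0 IHr; ring.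
Qed.

End ElementaryProduct.

(** * Weighted sums over words *)

Section Words.
Variables (R : comNzRingType) (I : finType) (x : I -> R).

(** Recursion on the first letter makes the peeling of words definitional. *)
Fixpoint word_sum n (F : seq I -> R) : R :=
  if n is k.+1 then \sum_a word_sum k (fun s => F (a :: s)) else F [::].

Lemma eq_word_sum n F G :
  (forall s, size s = n -> F s = G s) -> word_sum n F = word_sum n G.
Proof.
elim: n F G => [|n IHn] F G eqFG /=; first exact: eqFG.
by apply: eq_bigr => a _; apply: IHn => s sz; rewrite eqFG //= sz.
Qed.

Lemma word_sumMl n c F :
  word_sum n (fun s => c * F s) = c * word_sum n F.
Proof.
by elim: n F => [|n IHn] F //=; rewrite mulr_sumr; apply: eq_bigr => a _.
Qed.

Definition neq_rel : rel I := fun a b => a != b.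

Definition weight (s : seq I) : R := \prod_(a <- s) x a.

(** [n] counts the letters after [a], so the words have [n.+1] letters. *)
Definition path_weight (om : seq I -> R) n a : R :=
  word_sum n (fun s => (path neq_rel a s)%:R * weight (a :: s) * om (a :: s)).

Lemma path_weightS om n a :
    (forall b s, size s = n -> om [:: a, b & s] = om (b :: s)) ->
  path_weight om n.+1 a = x a * \sum_(b | b != a) path_weight om n b.
Proof.
move=> omE; rewrite /path_weight /= [in RHS]big_mkcond /= mulr_sumr.
apply: eq_bigr => b _.
transitivity (word_sum n (fun s => (b != a)%:R * x a *
    ((path neq_rel b s)%:R * weight (b :: s) * om (b :: s)))).
  apply: eq_word_sum => s sz; rewrite omE // /neq_rel eq_sym -mulnb natrM.
  by rewrite /weight [in LHS]big_cons; ring.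
by rewrite word_sumMl; case: ifP => _; rewrite ?mul1r // !mul0r mulr0.
Qed.

Definition path_words_series : zseries R :=
  ZSeries (fun n => word_sum n (fun s => (sorted neq_rel s)%:R * weight s)).

(** Let [W a] count the nonempty proper words starting with [a]. The recursion on the first letter
    gives W_a = u_a X, and X = 1 + sum_a W_a, where 1 is the empty word. *)
Lemma path_words_seriesM :
  path_words_series * (1 - \sum_a zlin_quot x a) = 1.
Proof.
pose W a : zseries R :=
  ZSeries (fun n => if n is k.+1 then path_weight (fun=> 1) k a else 0).
have WE a : W a = zlin x a * (1 + \sum_(b | b != a) W b).
  apply: zseriesP => n; rewrite /zlin -mulrA zcoef_constM zcoef_varM.
  case: n => [|[|n]]; rewrite ?mulr0 // zcoefD zcoef_sum zcoef1.
    rewrite big1 // addr0 mulr1 /W /= /path_weight /=.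
    by rewrite mul1r mulr1 /weight big_seq1.
  by rewrite add0r /= path_weightS.
have XW : path_words_series = 1 + \sum_a W a.
  apply: zseriesP => n; rewrite zcoefD zcoef_sum zcoef1; case: n => [|n].
    by rewrite /= big1 // addr0 mul1r /weight big_nil.
  rewrite add0r /=; apply: eq_bigr => a _; apply: eq_word_sum => s _.
  by rewrite /= mulr1.
have Wa a : W a = zlin_quot x a * path_words_series.
  have uE := zlin_quotK x a; set u := zlin_quot x a in uE *.
  set t := zlin x a in uE.
  have tW : (1 + t) * W a = t * path_words_series.
    rewrite XW (bigD1 a) //= mulrDl mul1r {1}WE -/t; ring.
  rewrite -[LHS]mul1r.
  have -> : 1 = (1 - u) * (1 + t) by rewrite mulrBl uE; ring.
  by rewrite -mulrA tW mulrA mulrBl -{1}uE; ring.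
rewrite mulrBr mulr1 mulr_sumr {1}XW (eq_bigr _ (fun a _ => Wa a)).
by rewrite (eq_bigr _ (fun a _ => mulrC _ _)) addrK.
Qed.

(** By the logarithmic derivative, E - z E' = E (1 - sum_a u_a). *)
Lemma path_words_elem (D := elem_prod x (index_enum I)
      - ztheta (elem_prod x (index_enum I))) :
  path_words_series * D = elem_prod x (index_enum I).
Proof.
rewrite /D elem_prod_theta -{1}[elem_prod _ _]mulr1 -mulrBr mulrCA.
by rewrite path_words_seriesM mulr1.
Qed.

(** The choices for the twin of a leaf coloured [a] whose neighbour is coloured [b]. *)
Definition pair_weight (a b : I) : R := \sum_(c | (c != a) && (c != b)) x c.

Definition front_weight (s : seq I) : R :=
  if s is a :: b :: _ then pair_weight a b else 0.

Definition end_weight (s : seq I) : R := front_weight (rev s).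

(** Two letters remain after the first is dropped, and the end weight reads only the last two. This
    lets [path_weightS] apply to [end_weight]. *)
Lemma end_weight_cons a b c s :
  end_weight [:: a, b, c & s] = end_weight [:: b, c & s].
Proof.
rewrite /end_weight [rev (a :: _)]rev_cons.
have : (1 < size (rev [:: b, c & s]))%N by rewrite size_rev.
by case: (rev _) => [|d [|d' l]].
Qed.

Definition twin_words n : R :=
  word_sum n (fun s => (sorted neq_rel s)%:R * weight s
                       * (front_weight s * end_weight s)).

Let e k := elem_prod x (index_enum I) k.

Definition triangle_weight (a : I) : R := e 2%N - e 1%N * x a + x a ^+ 2.

(** A leaf and its twin carry distinct colours other than that of their common neighbour [b]; the
    ordered pairs count e_2 of the variables other than x_b twice. *)
Lemma pair_weight_sum b :
  \sum_(a | a != b) x a * pair_weight a b = triangle_weight b *+ 2.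
Proof.
have pwE a : a != b -> pair_weight a b = e 1%N - x a - x b.
  move=> ab; rewrite /e -newton1 (bigD1 a) //= (bigD1 b) /=; last first.
    by rewrite eq_sym.
  by rewrite /pair_weight; ring.
transitivity (\sum_(a | a != b) ((e 1%N - x b) * x a - x a ^+ 2)).
  by apply: eq_bigr => a ab; rewrite pwE //; ring.
rewrite sumrB -mulr_sumr.
have := newton1 x (index_enum I); rewrite (bigD1 b) //= -/(e 1%N).
have := newton2 x (index_enum I); rewrite (bigD1 b) //= -/(e 1%N) -/(e 2%N).
move=> /(canRL (addKr _)) -> /(canRL (addKr _)) ->.
by rewrite /triangle_weight; ring.
Qed.

(** The first letter and its twin are summed out against the second letter [b], leaving a word that
    starts with [b] and keeps its end weight. *)
Lemma twin_wordsE n :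
  twin_words n.+3
    = \sum_b triangle_weight b *+ 2 * path_weight end_weight n.+1 b.
Proof.
(* Positivity of [k] ensures a letter after [b], as [end_weight_cons] requires. *)
rewrite /twin_words; have := ltn0Sn n; move: n.+1 => k k_gt0.
transitivity (\sum_a \sum_b (a != b)%:R * x a * pair_weight a b *
                path_weight end_weight k b).
  rewrite [LHS]/=; apply: eq_bigr => a _; apply: eq_bigr => b _.
  rewrite /path_weight -word_sumMl; apply: eq_word_sum => -[|c s] sz.
    by rewrite -sz in k_gt0.
  rewrite end_weight_cons /front_weight /= {1}/neq_rel -mulnb natrM.
  rewrite /weight [in LHS]big_cons; ring.
rewrite exchange_big /=; apply: eq_bigr => b _.
rewrite -mulr_suml -pair_weight_sum [in RHS]big_mkcond /=; congr (_ * _).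
by apply: eq_bigr => a _; case: (a != b); rewrite ?mul1r ?mul0r.
Qed.

Lemma path_weight_end1 a :
  path_weight end_weight 1 a = x a * (triangle_weight a *+ 2).
Proof.
rewrite -pair_weight_sum mulr_sumr [in RHS]big_mkcond /=.
apply: eq_bigr => b _; rewrite /end_weight /front_weight /= andbT {1}/neq_rel.
rewrite eq_sym /weight big_cons big_seq1.
by case: (b != a); rewrite ?mul1r ?mulrA ?mul0r.
Qed.

Lemma path_weight_endS n a :
  path_weight end_weight n.+2 a
    = x a * \sum_(b | b != a) path_weight end_weight n.+1 b.
Proof.
by apply: path_weightS => b [|c s] // _; rewrite end_weight_cons.
Qed.

(** The exponent counts all vertices, the two twins included. *)
Definition twin_words_series : zseries R :=
  ZSeries (fun k => if (5 <= k)%N then twin_words (k - 2) else 0).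

Local Notation z := (zvar R).
Local Notation Ez k := (zconst (e k) * z ^+ k).

(** [marked_words_total] applies to the inner letters, with z^2 for each pair of a leaf and its
    twin. Its result is quadratic in the mark [w], which is 2 f_a; hence the factor 4. *)
Lemma twin_words_seriesE (X := path_words_series)
    (E := elem_prod x (index_enum I)) :
  let D := E - ztheta E in
  let G3 := 1 - Ez 2%N - D in
  let E_3 := E - 1 - Ez 1%N - Ez 2%N in
  twin_words_series
  = (X * G3 ^+ 2 + (ztheta E - Ez 1%N - Ez 2%N *+ 2 - Ez 3%N *+ 3 - Ez 4%N *+ 4)
     + G3 * E_3 + Ez 1%N * (G3 - Ez 3%N *+ 2) + Ez 2%N * (G3 - E_3)) *+ 4.
Proof.
move=> D G3 E_3; rewrite -twin_form_collect; last exact: path_words_elem.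
(* The exponent in [T a] counts the inner letters, [a] being the first; the far leaf is in the word
   but not in the exponent. *)
pose T a : zseries R := ZSeries (fun k =>
   if k is m.+1 then path_weight end_weight m.+1 a else 0).
pose w a : zseries R := zconst (triangle_weight a *+ 2) * z ^+ 2.
have wE a : w a = (Ez 2%N - Ez 1%N * zlin x a + zlin x a ^+ 2) *+ 2.
  rewrite /w zconstMn /triangle_weight zconstD zconstB zconstM zconstX /zlin.
  ring.
have TE a : z ^+ 2 * T a = zlin x a * (w a + \sum_(b | b != a) z ^+ 2 * T b).
  rewrite -mulr_sumr /w [zconst (_ *+ _) * _]mulrC -mulrDr mulrCA.
  congr (_ * _); apply: zseriesP => n.
  rewrite /zlin -mulrA zcoef_constM zcoef_varM.
  case: n => [|[|n]]; first by rewrite mulr0.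
    rewrite zcoefD zcoef_sum big1 // addr0.
    by rewrite [LHS]path_weight_end1.
  by rewrite zcoefD zcoef_sum add0r [LHS]path_weight_endS.
transitivity (\sum_a w a * (z ^+ 2 * T a)).
  transitivity (z ^+ 4 * \sum_a zconst (triangle_weight a *+ 2) * T a).
    apply: zseriesP => n; rewrite zcoef_varXM zcoef_sum.
    rewrite (eq_bigr _ (fun a _ => zcoef_constM _ _ _)) /=.
    case: n => [|[|[|[|[|n]]]]] //.
      by rewrite /= big1 // => a _; rewrite mulr0.
    by rewrite [LHS]twin_wordsE.
  by rewrite mulr_sumr; apply: eq_bigr => a _; rewrite /w; ring.
rewrite (marked_words_total (zlin_quotK x) TE path_words_seriesM).
rewrite -(@twin_quotient_sums _ _ (zlin x) (zlin_quot x)) //.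
- set f := fun a => Ez 2%N - Ez 1%N * zlin x a + zlin x a ^+ 2.
  rewrite (eq_bigr (fun a => zlin_quot x a * f a ^+ 2 *+ 4)); last first.
    by move=> a _; rewrite wE /f; ring.
  rewrite (eq_bigr (fun a => zlin_quot x a * f a *+ 2)
     (F1 := fun a => _ * w a)); last first.
    by move=> a _; rewrite wE /f; ring.
  by rewrite !sumrMnl /X; ring.
- exact: zlin_quotK.
- by rewrite -mulr_suml -zconst_sum newton1.
- rewrite (eq_bigr (fun a => zconst (x a ^+ 2) * z ^+ 2)) => [|a _]; last first.
    by rewrite exprMn zconstX.
  rewrite -mulr_suml -zconst_sum newton2 zconstB zconstMn zconstX.
  by rewrite /e; ring.
- rewrite (eq_bigr (fun a => zconst (x a ^+ 3) * z ^+ 3)) => [|a _]; last first.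
    by rewrite exprMn zconstX.
  rewrite -mulr_suml -zconst_sum newton3 zconstD zconstB !zconstMn zconstX.
  by rewrite zconstM /e; ring.
- rewrite (eq_bigr (fun a => zconst (x a ^+ 4) * z ^+ 4)) => [|a _]; last first.
    by rewrite exprMn zconstX.
  rewrite -mulr_suml -zconst_sum newton4 !(zconstB, zconstD, zconstMn).
  by rewrite !(zconstM, zconstX) /e; ring.
- exact: path_words_seriesM.
Qed.

End Words.

(** * Ring morphisms applied coefficientwise *)

Section ZMap.
Variables (R S : comNzRingType) (phi : {rmorphism R -> S}).

Definition zmap (f : zseries R) : zseries S := ZSeries (fun n => phi (f n)).

Fact zmap_is_zmod_morphism : zmod_morphism zmap.
Proof. by move=> f g; apply: zseriesP => n /=; rewrite rmorphB. Qed.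

Fact zmap_is_monoid_morphism : monoid_morphism zmap.
Proof.
split=> [|f g]; apply: zseriesP => n /=.
  by case: eqP; rewrite ?rmorph1 ?rmorph0.
by rewrite rmorph_sum; apply: eq_bigr => i _; rewrite rmorphM.
Qed.

HB.instance Definition _ :=
  GRing.isZmodMorphism.Build (zseries R) (zseries S) zmap
    zmap_is_zmod_morphism.
HB.instance Definition _ :=
  GRing.isMonoidMorphism.Build (zseries R) (zseries S) zmap
    zmap_is_monoid_morphism.

Lemma zmapD f g : zmap (f + g) = zmap f + zmap g. Proof. exact: rmorphD. Qed.

Lemma zmapN f : zmap (- f) = - zmap f. Proof. exact: rmorphN. Qed.

Lemma zmapM f g : zmap (f * g) = zmap f * zmap g. Proof. exact: rmorphM. Qed.

Lemma zmap1 : zmap 1 = 1. Proof. exact: rmorph1. Qed.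

Lemma zmapMn f n : zmap (f *+ n) = zmap f *+ n. Proof. exact: rmorphMn. Qed.

Lemma zmapXn f n : zmap (f ^+ n) = zmap f ^+ n. Proof. exact: rmorphXn. Qed.

Lemma zmap_const c : zmap (zconst c) = zconst (phi c).
Proof. by apply: zseriesP => n /=; case: eqP; rewrite ?rmorph0. Qed.

Lemma zmap_var : zmap (zvar R) = zvar S.
Proof. by apply: zseriesP => n /=; case: eqP; rewrite ?rmorph1 ?rmorph0. Qed.

Lemma zmap_theta f : zmap (ztheta f) = ztheta (zmap f).
Proof. by apply: zseriesP => n /=; rewrite rmorphMn. Qed.

End ZMap.

(** * Restriction to finitely many variables *)

Definition xmon (m : monomial) : xseries := XSeries (fun m' => (m' == m)%:R).

Lemma xcoef_monM m f m' :
  (xmon m * f) m' = if msubset m m' then f (msetB m' m) else 0.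
Proof.
rewrite /=; case: ifPn => [mm'|nmm'].
  rewrite (bigD1_seq m) ?mdivisors_uniq ?mem_mdivisors //= eqxx mul1r.
  by rewrite big1 ?addr0 // => d /negPf->; rewrite mul0r.
rewrite big_seq big1 // => d; rewrite mem_mdivisors.
by case: eqP => [->|]; rewrite ?mul0r // (negPf nmm').
Qed.

Lemma xcoefD (f g : xseries) m : (f + g) m = f m + g m. Proof. by []. Qed.

Lemma xcoef_sum (I : Type) (r : seq I) (P : pred I) (F : I -> xseries) m :
  (\sum_(i <- r | P i) F i) m = \sum_(i <- r | P i) F i m.
Proof. by elim/big_rec2: _ => // i y1 y2 _ <-. Qed.

Definition xvar (i : nat) : xseries := xmon [mset i]%mset.

Lemma xvar_prod s : \prod_(i <- s) xvar i = xmon (seq_mset s).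
Proof.
elim: s => [|i s IHs].
  rewrite big_nil; apply: xseriesP => m /=; congr (m == _)%:R.
  by apply/msetP => j; rewrite mset_seqE mset0E.
rewrite big_cons IHs; apply: xseriesP => m; rewrite xcoef_monM mset_cons /=.
case: ifPn => [im|nim].
  congr (nat_of_bool _)%:R; apply/eqP/eqP => [<-|->].
    by rewrite msetBDKC.
  by rewrite msetDKB.
case: eqP => // mE; case/negP: nim; rewrite mE; apply/msubsetP => j.
by rewrite msetE2 leq_addr.
Qed.

(* Substitution of 0 for the variables of index at least N. *)
Definition xres (N : nat) (f : xseries) : xseries :=
  XSeries (fun m => if all (fun i => i < N)%N m then f m else 0).

Fact xres_is_zmod_morphism N : zmod_morphism (xres N).
Proof.
by move=> f g; apply: xseriesP => m /=; case: all; rewrite ?subr0.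
Qed.

(** A product of two monomials avoids the variables of index at least [N] exactly when both factors
    do. *)
Fact xres_is_monoid_morphism N : monoid_morphism (xres N).
Proof.
split=> [|f g]; apply: xseriesP => m /=.
  case: ifPn => // /negP nall; case: eqP => // m0; case: nall.
  by rewrite m0 enum_mset0.
case: ifPn => [/allP mN|nmN].
  apply: eq_big_seq => d; rewrite mem_mdivisors => /msubset_subset dm.
  have dm' := msubset_subset (msubsetDl m d).
  by rewrite !ifT //; apply/allP => i; [move/dm' | move/dm]; apply: mN.
rewrite big_seq big1 // => d; rewrite mem_mdivisors => dm.
case: ifPn; rewrite ?mul0r // => /allP dN.
case: ifPn; rewrite ?mulr0 // => /allP mdN.
case/negP: nmN; rewrite -(msetBDKC dm); apply/allP => i.
by rewrite in_msetD => /orP[/dN | /mdN].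
Qed.

HB.instance Definition _ N :=
  GRing.isZmodMorphism.Build xseries xseries (xres N)
    (xres_is_zmod_morphism N).
HB.instance Definition _ N :=
  GRing.isMonoidMorphism.Build xseries xseries (xres N)
    (xres_is_monoid_morphism N).

(** Each monomial survives once [N] reaches its largest index. The successor keeps the colour set
    ['I_N.+1] inhabited. *)
Lemma xres_inj f g : (forall N, xres N.+1 f = xres N.+1 g) -> f = g.
Proof.
move=> eqfg; apply: xseriesP => m.
have mN : all (fun i => i < (\max_(j <- m) j).+1)%N m.
  by apply/allP => i im; rewrite ltnS (leq_bigmax_seq (F := id)).
have /(congr1 (fun h => xcoef h m)) := eqfg (\max_(j <- m) j)%N.
by rewrite /= mN.
Qed.

Lemma zres_inj f g :
  (forall N, zmap (xres N.+1) f = zmap (xres N.+1) g) -> f = g.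
Proof.
move=> eqfg; apply: zseriesP => n; apply: xres_inj => N.
exact: (congr1 (fun h => zcoef h n) (eqfg N)).
Qed.

Lemma xcoef_varM i f m :
  (xvar i * f) m = if i \in m then f (msetB m [mset i]%mset) else 0.
Proof. by rewrite xcoef_monM msub1set. Qed.

(** Induction on [r]: of the two terms for a new letter [a], only the one with x_a can contribute if
    [a] occurs in [m], and only the other if it does not. *)
Lemma elem_prod_coef r k m : uniq r ->
  elem_prod xvar r k m = [&& uniq m, size m == k & all (mem r) m]%:R.
Proof.
elim: r k m => [|a r IHr] k m.
  move=> _; rewrite elem_prod_nil; case: k => [|k].
    rewrite size_mset_eq0 /=; case: eqP => [->|]; last by rewrite andbF.
    by rewrite enum_mset0.
  by case: (enum_mset m) => [|i s]; rewrite ?andbF.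
move=> /= /andP[ar ur]; case: k => [|k].
  rewrite elem_prod_cons0 IHr // size_mset_eq0; case: eqP => [->|].
    by rewrite enum_mset0.
  by rewrite !andbF.
rewrite elem_prod_consS xcoefD xcoef_varM !IHr //.
case: ifPn => [am|nam]; last first.
  rewrite addr0; congr (nat_of_bool [&& _, _ & _])%:R.
  apply: eq_in_all => i im /=; rewrite inE; case: eqP => // ia.
  by rewrite -ia im in nam.
have nall : all (mem r) m = false.
  by apply/negP => /allP /(_ _ am); rewrite inE (negPf ar).
rewrite nall !andbF add0r; set d := msetB m _.
have pm : perm_eq m (a :: d).
  apply/eq_seq_msetP; rewrite mset_cons !seq_mset_id.
  by rewrite msetB1K.
rewrite (perm_uniq pm) (perm_size pm) (perm_all _ pm) /= eqSS !inE eqxx /=.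
congr (nat_of_bool _)%:R.
have [ud|] := boolP (uniq d); rewrite ?andbF // andbT.
case: eqP => _; rewrite ?andbF //=.
apply/idP/andP => [/allP dr|[ad /allP dr]].
  split; first by apply: contra ar => /dr.
  by apply/allP => i /dr /= ir; rewrite inE ir orbT.
apply/allP => i id; have := dr i id; rewrite /= inE => /orP[/eqP ia|//].
by rewrite -ia id in ad.
Qed.

Lemma xres_elem_sym N k :
  xres N (elem_sym k) = elem_prod (fun i : 'I_N => xvar i) (index_enum 'I_N) k.
Proof.
have -> : elem_prod (fun i : 'I_N => xvar i) (index_enum 'I_N)
    = elem_prod xvar (iota 0 N).
  by rewrite /elem_prod -val_enum_ord big_map enumT.
apply: xseriesP => m; rewrite elem_prod_coef ?iota_uniq //=.
have -> : all (mem (iota 0 N)) m = all (fun i => i < N)%N m.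
  by apply: eq_all => i /=; rewrite mem_iota.
by case: all; rewrite ?andbT ?andbF.
Qed.

Definition proper_col (H : sgraph) (I : finType) (kappa : H -> I) : bool :=
  [forall u, forall w, adj u w ==> (kappa u != kappa w)].

(** A colouring with monomial [m] uses only colours of [m], so taking values in [finsupp m] or in
    ['I_N.+1] gives the same count when [m] survives; otherwise no colouring into ['I_N.+1] has
    monomial [m]. *)
Lemma xres_chromatic (H : sgraph) N :
  xres N.+1 (chromatic_sym H)
    = \sum_(kappa : {ffun H -> 'I_N.+1} | proper_col kappa)
        \prod_(u : H) xvar (kappa u).
Proof.
apply: xseriesP => m; rewrite xcoef_sum.
pose col (I : finType) (f : I -> nat) (kappa : {ffun H -> I}) :=
  proper_col kappa && (seq_mset [seq f (kappa u) | u <- enum H] == m).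
transitivity (#|[set kappa | col 'I_N.+1 val kappa]|%:R : rat); last first.
  rewrite -sum1_card natr_sum big_mkcond /= [RHS]big_mkcond /=.
  apply: eq_bigr => kappa _; rewrite inE /col.
  have -> : \prod_(u : H) xvar (kappa u)
      = xmon (seq_mset [seq val (kappa u) | u <- enum H]).
    by rewrite -xvar_prod big_map big_enum.
  by case: proper_col => //=; rewrite eq_sym; case: eqP.
rewrite [LHS]/=; case: ifPn => [/allP mN|nmN]; last first.
  rewrite (_ : [set _ | _] = set0) ?cards0 //.
  apply/setP => kappa; rewrite !inE.
  apply/negP => /andP[_ /eqP mE]; case/negP: nmN.
  rewrite -mE (perm_all _ (perm_eq_seq_mset _)) all_map; apply/allP => u _ /=.
  exact: ltn_ord.
(* The default of [inord] never occurs, since all indices in [m] are below [N.+1]. *)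
congr (_%:R); pose g (kappa : {ffun H -> finsupp m}) : {ffun H -> 'I_N.+1} :=
  [ffun u => inord (val (kappa u))].
have gE kappa u : val (g kappa u) = val (kappa u).
  rewrite ffunE /= inordK //; apply: mN; rewrite -msuppE; exact: valP.
have g_inj : injective g.
  move=> k1 k2 eqk; apply/ffunP => u; apply: val_inj.
  by rewrite -!gE eqk.
rewrite -(card_imset _ g_inj); congr #|pred_of_set _|; apply/setP => kappa.
rewrite inE; apply/imsetP/idP => [[k1]|]; rewrite ?inE.
  move=> /andP[/forallP pk /eqP mE] ->; apply/andP; split.
    apply/forallP => u; apply/forallP => w; apply/implyP => uw.
    have /forallP/(_ w)/implyP/(_ uw) := pk u; apply: contra => /eqP eqg.
    by apply/eqP/val_inj; rewrite -!gE eqg.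
  by apply/eqP; rewrite -[RHS]mE; congr seq_mset; apply: eq_map => u; apply: gE.
move=> /andP[/forallP pk /eqP mE].
have km u : val (kappa u) \in finsupp m.
  rewrite msuppE -mE (perm_mem (perm_eq_seq_mset _)).
  by apply: map_f; rewrite mem_enum.
pose k1 : {ffun H -> finsupp m} := [ffun u => FSetSub (km u)].
have gk : g k1 = kappa.
  by apply/ffunP => u; apply: val_inj; rewrite gE ffunE.
exists k1; rewrite // inE; apply/andP; split.
  apply/forallP => u; apply/forallP => w; apply/implyP => uw.
  have /forallP/(_ w)/implyP/(_ uw) := pk u; apply: contra => /eqP eqk.
  by rewrite -gk; apply/eqP/val_inj; rewrite !gE eqk.
apply/eqP; rewrite -[RHS]mE; congr seq_mset; apply: eq_map => u.
by rewrite ffunE.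
Qed.

(** * Colorings as words *)

Section ColoringSums.
Variables (R : comNzRingType) (I : finType) (x : I -> R).

Definition ffun_option (V : finType) (p : I * {ffun V -> I}) :
    {ffun option V -> I} :=
  [ffun o => if o is Some v then p.2 v else p.1].

Lemma sum_ffun_option (V : finType) (F : {ffun option V -> I} -> R) :
  \sum_kappa F kappa = \sum_c \sum_g F (ffun_option (c, g)).
Proof.
rewrite pair_big /= (reindex (@ffun_option V)) /=; last first.
  exists (fun kappa => (kappa None, [ffun v => kappa (Some v)])).
    move=> [c g] _; rewrite ffunE; congr (_, _).
    by apply/ffunP => v; rewrite !ffunE.
  by move=> kappa _; apply/ffunP => -[v|]; rewrite !ffunE.
by apply: eq_bigr => -[c g].
Qed.

Lemma prod_option (V : finType) (F : option V -> R) :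
  \prod_o F o = F None * \prod_v F (Some v).
Proof.
rewrite (bigD1 None) //= (reindex_omap Some id) => [|[] //] /=.
by congr (_ * _); apply: eq_bigl => v; rewrite eqxx.
Qed.

(** Splitting off the value at [ord0] matches one unfolding of [word_sum]. *)
Lemma sum_ffun_word n (F : seq I -> R) :
  \sum_(kappa : {ffun 'I_n -> I}) F [seq kappa i | i <- enum 'I_n]
    = word_sum n F.
Proof.
elim: n F => [|n IHn] F /=.
  have s0 (kappa : {ffun 'I_0 -> I}) : [seq kappa i | i <- enum 'I_0] = [::].
    by apply: size0nil; rewrite size_map size_enum_ord.
  rewrite (eq_bigr _ (fun kappa _ => congr1 F (s0 kappa))) sumr_const.
  by rewrite card_ffun card_ord expn0.
pose h (p : I * {ffun 'I_n -> I}) : {ffun 'I_n.+1 -> I} :=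
  [ffun i => if unlift ord0 i is Some j then p.2 j else p.1].
rewrite (reindex h) /=; last first.
  exists (fun kappa => (kappa ord0, [ffun j => kappa (lift ord0 j)])).
    move=> [c g] _; rewrite ffunE unlift_none; congr (_, _).
    by apply/ffunP => j; rewrite !ffunE liftK.
  move=> kappa _; apply/ffunP => i; rewrite !ffunE.
  by case: unliftP => [j|] ->; rewrite ?ffunE.
transitivity (\sum_c \sum_(g : {ffun 'I_n -> I})
    F (c :: [seq g i | i <- enum 'I_n])).
  rewrite pair_big /=; apply: eq_bigr => -[c g] _ /=; congr F.
  rewrite enum_ordSl /= -map_comp ffunE unlift_none; congr (_ :: _).
  by apply: eq_map => j /=; rewrite ffunE liftK.
by apply: eq_bigr => c _; rewrite (IHn (fun s => F (c :: s))).
Qed.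

Lemma proper_col_path n (g : {ffun 'I_n -> I}) :
  proper_col (H := path_graph n) g
    = sorted (@neq_rel I) [seq g i | i <- enum 'I_n].
Proof.
case: n g => [|n] g.
  have -> : [seq g i | i <- enum 'I_0] = [::].
    by apply: size0nil; rewrite size_map size_enum_ord.
  by apply/forallP => -[].
have nthg (k : nat) (lt_kn : (k < n.+1)%N) :
    nth (g ord0) (map g (enum 'I_n.+1)) k = g (Ordinal lt_kn).
  rewrite (nth_map ord0) ?size_enum_ord //; congr (g _).
  by apply: val_inj; rewrite /= nth_enum_ord.
apply/idP/(sortedP (g ord0)) => [/forallP pg i|sg].
  rewrite size_map size_enum_ord => lt_i1.
  have lt_i := ltnW lt_i1.
  rewrite (nthg _ lt_i) (nthg _ lt_i1).
  have /forallP/(_ (Ordinal lt_i1)) := pg (Ordinal lt_i).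
  by rewrite /= /path_adj /= eqxx.
have dg (i j : 'I_n.+1) : j = i.+1 :> nat -> g i != g j.
  case: i j => i lt_i [j lt_j] /= ji; rewrite ji in lt_j *.
  have := sg i; rewrite (nthg _ lt_i) (nthg _ lt_j) size_map size_enum_ord.
  by apply.
apply/forallP => i; apply/forallP => j; apply/implyP.
by move=> /orP[] /eqP /dg; rewrite // eq_sym.
Qed.

Lemma proper_col_twin (H : sgraph) (v : H) c (g : {ffun H -> I}) :
  proper_col (H := twin v) (ffun_option (c, g))
    = proper_col g && [forall u, (u == v) || adj v u ==> (c != g u)].
Proof.
apply/forallP/andP => [pk|[/forallP pg /forallP pc] a].
  split; apply/forallP => u.
    apply/forallP => w; have /forallP/(_ (Some w)) := pk (Some u).
    by rewrite !ffunE.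
  by have /forallP/(_ (Some u)) := pk None; rewrite !ffunE.
apply/forallP => b; rewrite !ffunE; case: a b => [u|] [w|] //=.
- exact: (forallP (pg u)).
- by rewrite [_ == c]eq_sym; apply: pc.
Qed.

Lemma sum_chromatic_path n :
  \sum_(kappa : {ffun path_graph n -> I} | proper_col kappa)
     \prod_u x (kappa u)
  = word_sum n (fun s => (sorted (@neq_rel I) s)%:R * weight x s).
Proof.
rewrite -sum_ffun_word big_mkcond /=; apply: eq_bigr => g _.
rewrite proper_col_path /weight big_map big_enum /=.
by case: sorted; rewrite ?mul1r ?mul0r.
Qed.

(** For a fixed colouring of the path, the constraints on the two twins are independent, so their
    colours sum to a product of two pair weights. *)
Lemma sum_chromatic_twinned n :
  \sum_(kappa : {ffun twinned_path n.+3 -> I} | proper_col kappa)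
     \prod_u x (kappa u)
  = twin_words x n.+3.
Proof.
rewrite /twin_words -sum_ffun_word big_mkcond /= sum_ffun_option.
rewrite (eq_bigr _ (fun c' _ => sum_ffun_option _)) /=.
under eq_bigr do rewrite exchange_big /=.
rewrite exchange_big /=; apply: eq_bigr => g _.
pose lst : 'I_n.+3 := ord_max; pose pen : 'I_n.+3 := inord n.+1.
pose fst : 'I_n.+3 := ord0; pose snd : 'I_n.+3 := inord 1.
have frontE : front_weight x [seq g i | i <- enum 'I_n.+3]
    = pair_weight x (g fst) (g snd).
  rewrite 2!enum_ordSl /=; congr (pair_weight x _ (g _)).
  by apply: val_inj; rewrite /= inordK.
have endE : end_weight x [seq g i | i <- enum 'I_n.+3]
    = pair_weight x (g lst) (g pen).
  rewrite /end_weight -map_rev 2!enum_ordSr map_rcons !rev_rcons /=.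
  by congr (pair_weight x _ (g _)); apply: val_inj; rewrite /= inordK.
rewrite frontE endE {frontE endE}.
have cE c c' : proper_col (H := twinned_path n.+3)
      (ffun_option (c', ffun_option (c, g)))
    = [&& sorted (@neq_rel I) [seq g i | i <- enum 'I_n.+3],
          (c != g fst) && (c != g snd) & (c' != g lst) && (c' != g pen)].
  rewrite proper_col_twin proper_col_twin proper_col_path -andbA.
  congr [&& _, _ & _].
    apply/forallP/andP => [pc|[c0 c1] u].
      split; first by have := pc ord0; rewrite eqxx.
      by have := pc snd; rewrite /= /path_adj /snd /= inordK //= orbT.
    apply/implyP => /orP[/eqP -> //|/orP[]/eqP //= u1].
    by rewrite (_ : u = snd) //; apply: val_inj; rewrite /= inordK.
  apply/forallP/andP => [pc|[cl cp] [u|]].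
  - split; first by have := pc (Some lst); rewrite eqxx ffunE.
    have := pc (Some pen); rewrite ffunE /= /path_adj /pen /= inordK //.
    by rewrite eqxx !orbT.
  - rewrite ffunE /=; apply/implyP => /orP[/eqP[->] //|/orP[]/eqP /= ul].
      by have := ltn_ord u; rewrite ul ltnn.
    case: ul => ul; rewrite (_ : u = pen) //; apply: val_inj.
    by rewrite /= inordK.
  (* The two twins are not adjacent: on at least three vertices, the last one is neither the first
     nor its neighbour. *)
  - by rewrite ffunE /= /path_adj.
under eq_bigr => c' _ do under eq_bigr => c _ do rewrite cE.
rewrite /pair_weight /weight big_map big_enum /=.
case: sorted => /=; last first.
  by rewrite !mul0r big1 // => c' _; rewrite big1.
rewrite mul1r; set P := \prod_i _.
transitivity (\sum_c' (if (c' != g lst) && (c' != g pen) then x c' else 0) *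
    ((\sum_(c | (c != g fst) && (c != g snd)) x c) * P)).
  apply: eq_bigr => c' _; rewrite mulr_suml mulr_sumr [RHS]big_mkcond /=.
  apply: eq_bigr => c _; rewrite !prod_option !ffunE.
  case: (_ != g fst) => //=; case: (_ != g snd) => //=.
  case: (_ && _); rewrite ?mul0r //.
  by congr (_ * (_ * _)); apply: eq_bigr => i _; rewrite !ffunE.
by rewrite -mulr_suml -[in LHS]big_mkcond /=; ring.
Qed.
End ColoringSums.

(** * The series of the statement in terms of E, z E' and low-degree terms *)

Definition Ez : zseries xseries := zsum 0 0 elem_sym.

Definition ez (k : nat) : zseries xseries :=
  zconst (elem_sym k) * zvar xseries ^+ k.

Lemma elem_sym0 : elem_sym 0 = 1.
Proof.
apply: xseriesP => m /=; rewrite size_mset_eq0; congr (nat_of_bool _)%:R.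
by case: eqP => [->|]; rewrite ?andbF // enum_mset0.
Qed.

Lemma zcoef_Ez n : Ez n = elem_sym n. Proof. by rewrite /= subn0. Qed.

Lemma zcoef_sum0 m a n : zsum m 0 a n = if (m <= n)%N then a n else 0.
Proof. by rewrite /= addn0 subn0. Qed.

Lemma zres_Ez N :
  zmap (xres N) Ez = elem_prod (fun i : 'I_N => xvar i) (index_enum 'I_N).
Proof. by apply: zseriesP => n; rewrite /= subn0 xres_elem_sym. Qed.

Lemma zres_XP N :
  zmap (xres N.+1) XP
    = path_words_series (fun i : 'I_N.+1 => xvar i).
Proof.
apply: zseriesP => n; rewrite /= subn0 xres_chromatic.
exact: sum_chromatic_path.
Qed.

Lemma zres_twinned N :
  zmap (xres N.+1) (zsum 3 2 (fun n => chromatic_sym (twinned_path n)))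
    = twin_words_series (fun i : 'I_N.+1 => xvar i).
Proof.
apply: zseriesP => -[|[|[|[|[|n]]]]]; rewrite /= ?rmorph0 //.
rewrite xres_chromatic; exact: sum_chromatic_twinned.
Qed.

(** The coefficient (1 - i) e_i is 1 at i = 0 and vanishes at i = 1. *)
Lemma Dz_theta : Dz = Ez - ztheta Ez.
Proof.
apply: zseriesP => n; rewrite /Dz !zcoefB zcoef_theta zcoef_Ez zcoef1.
rewrite /Gz /G_ge zcoef_sum0.
case: n => [|[|n]]; rewrite /= ?subr0 ?elem_sym0 ?subrr //.
by rewrite subn1 /= [in RHS]mulrS; ring.
Qed.

(** The classical formula X_P = E / (E - z E'), checked in finitely many variables. *)
Lemma XP_Dz : XP * Dz = Ez.
Proof.
apply: zres_inj => N; rewrite Dz_theta zmapM zmapD zmapN zmap_theta zres_Ez.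
by rewrite zres_XP path_words_elem.
Qed.

Lemma G_ge3E : G_ge 3 = 1 - ez 2 - Dz.
Proof.
have -> : 1 - ez 2 - Dz = Gz - ez 2 by rewrite /Dz; ring.
apply: zseriesP => n; rewrite zcoefB zcoef_monom !zcoef_sum0.
by case: n => [|[|[|n]]]; rewrite ?mulr0n ?mulr1n ?subr0 ?subrr.
Qed.

Lemma G_ge4E : G_ge 4 = G_ge 3 - ez 3 *+ 2.
Proof.
apply: zseriesP => n; rewrite zcoefB zcoefMn zcoef_monom !zcoef_sum0.
by case: n => [|[|[|[|n]]]]; rewrite ?mulr0n ?mulr1n ?mul0rn ?subr0 ?subrr.
Qed.

Lemma E_ge3E : zsum 3 0 elem_sym = Ez - 1 - ez 1 - ez 2.
Proof.
apply: zseriesP => n; rewrite !zcoefB zcoef1 !zcoef_monom !zcoef_sum0.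
case: n => [|[|[|n]]]; rewrite ?elem_sym0 /= ?mulr0n ?mulr1n ?subr0 //.
- by rewrite subrr.
- by rewrite subrr.
- by rewrite subrr.
Qed.

Lemma E_sub2E :
  zsum 3 0 (fun i => elem_sym i *+ (i - 2)) = G_ge 3 - zsum 3 0 elem_sym.
Proof.
apply: zseriesP => n; rewrite zcoefB !zcoef_sum0.
by case: n => [|[|[|n]]]; rewrite ?subr0 //= !subSS !subn0 [in RHS]mulrSr addrK.
Qed.

Lemma K_ge5E :
  K_ge 5 = ztheta Ez - ez 1 - ez 2 *+ 2 - ez 3 *+ 3 - ez 4 *+ 4.
Proof.
apply: zseriesP => n; rewrite !zcoefB !zcoefMn zcoef_theta.
rewrite zcoef_Ez !zcoef_monom zcoef_sum0.
by case: n => [|[|[|[|[|n]]]]] /=;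
  rewrite ?mulr0n ?mulr1n ?mul0rn ?subr0 ?subrr ?subr0.
Qed.

Lemma zres_ez N k (x := fun i : 'I_N => xvar i) :
  zmap (xres N) (ez k)
    = zconst (elem_prod x (index_enum 'I_N) k) * zvar xseries ^+ k.
Proof.
rewrite zmapM zmapXn zmap_const zmap_var; congr (zconst _ * _).
exact: xres_elem_sym.
Qed.

(** Restricted to [N.+1] variables, both sides become those of [twin_words_seriesE]. *)
Lemma twinned_seriesE :
  zsum 3 2 (fun n => chromatic_sym (twinned_path n))
  = (XP * G_ge 3 ^+ 2 + K_ge 5 + G_ge 3 * zsum 3 0 elem_sym
     + ez 1 * G_ge 4
     + ez 2 * zsum 3 0 (fun i => elem_sym i *+ (i - 2))) *+ 4.
Proof.
apply: zres_inj => N.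
rewrite E_sub2E G_ge4E E_ge3E K_ge5E G_ge3E Dz_theta.
rewrite zres_twinned twin_words_seriesE.
rewrite !(zres_ez, zmapMn, zmapXn, zmapM, zmapN, zmapD, zmap1).
by rewrite zres_XP zmap_theta zres_Ez.
Qed.

(** * e-positivity *)

Definition part_of (l : seq nat) : seq nat :=
  sort geq [seq i <- l | i != 0%N].

Lemma part_ofP l : is_partition (part_of l).
Proof.
rewrite /is_partition sort_sorted /=; last by move=> i j; apply: leq_total.
by rewrite mem_sort mem_filter eqxx.
Qed.

Lemma elem_sym_part_of l : elem_sym_part (part_of l) = elem_sym_part l.
Proof.
rewrite /elem_sym_part /part_of.
rewrite (perm_big [seq i <- l | i != 0%N]) ?perm_sort //= big_filter.
rewrite big_mkcond; apply: eq_bigr => i _.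
by case: eqP => // ->; rewrite elem_sym0.
Qed.

(** Grouping the terms by their partition makes the indices distinct. Closure properties may thus
    use lists with repeated or unsorted indices. *)
Lemma e_positive_terms (s : seq (rat * seq nat)) :
    all (fun p => 0 <= p.1) s ->
  e_positive (\sum_(p <- s) p.1 *: elem_sym_part p.2).
Proof.
move=> /allP s_ge0.
exists (undup [seq part_of p.2 | p <- s]).
exists (fun l => \sum_(p <- s | part_of p.2 == l) p.1); split.
- exact: undup_uniq.
- apply/allP => l; rewrite mem_undup => /mapP[p _ ->]; exact: part_ofP.
- by move=> l; rewrite big_seq_cond sumr_ge0 // => p /andP[/s_ge0].
transitivity (\sum_(l <- undup [seq part_of p.2 | p <- s])
    \sum_(p <- s) (if part_of p.2 == l then p.1 *: elem_sym_part p.2 else 0)).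
  rewrite exchange_big /=; apply: eq_big_seq => p ps.
  have pL : part_of p.2 \in undup [seq part_of p.2 | p <- s].
    by rewrite mem_undup; apply/mapP; exists p.
  rewrite (bigD1_seq _ pL) ?undup_uniq //= eqxx big1 ?addr0 // => l.
  by rewrite eq_sym => /negPf->.
apply: eq_bigr => l _; rewrite -big_mkcond scaler_suml.
by apply: eq_bigr => p /eqP <-; rewrite elem_sym_part_of.
Qed.

Lemma e_positiveP f : e_positive f ->
  exists2 s : seq (rat * seq nat), all (fun p => 0 <= p.1) s
    & f = \sum_(p <- s) p.1 *: elem_sym_part p.2.
Proof.
move=> [L [c [_ _ c_ge0 ->]]]; exists [seq (c l, l) | l <- L].
  by rewrite all_map; apply/allP => l _; apply: c_ge0.
by rewrite big_map.
Qed.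

Lemma e_positiveD f g : e_positive f -> e_positive g -> e_positive (f + g).
Proof.
move=> /e_positiveP[s s0 ->] /e_positiveP[t t0 ->].
by rewrite -big_cat; apply: e_positive_terms; rewrite all_cat s0.
Qed.

(** Products of elementary functions multiply by concatenating their index lists. *)
Lemma e_positiveM f g : e_positive f -> e_positive g -> e_positive (f * g).
Proof.
move=> /e_positiveP[s /allP s0 ->] /e_positiveP[t /allP t0 ->].
have := @e_positive_terms [seq (p.1 * q.1, p.2 ++ q.2) | p <- s, q <- t].
rewrite big_allpairs_dep /=.
suff -> : \sum_(p <- s) \sum_(q <- t) (p.1 * q.1) *: elem_sym_part (p.2 ++ q.2)
    = (\sum_(p <- s) p.1 *: elem_sym_part p.2)
      * (\sum_(q <- t) q.1 *: elem_sym_part q.2).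
  apply; apply/allP => _ /allpairsP[[p q] [/s0 p0 /t0 q0 ->]].
  exact: mulr_ge0.
rewrite mulr_suml; apply: eq_bigr => p _; rewrite mulr_sumr.
apply: eq_bigr => q _; rewrite /elem_sym_part big_cat /=.
by rewrite -scalerAl -scalerAr scalerA.
Qed.

Lemma e_positive0 : e_positive 0.
Proof. by have := @e_positive_terms [::] isT; rewrite big_nil. Qed.

Lemma e_positive1 : e_positive 1.
Proof.
have := @e_positive_terms [:: (1, [::])] isT.
by rewrite big_seq1 scale1r /elem_sym_part big_nil.
Qed.

Lemma e_positive_elem k : e_positive (elem_sym k).
Proof.
have := @e_positive_terms [:: (1, [:: k])] isT.
by rewrite big_seq1 scale1r /elem_sym_part big_seq1.
Qed.

Lemma e_positiveMn f n : e_positive f -> e_positive (f *+ n).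
Proof.
move=> f_pos; elim: n => [|n IHn]; first exact: e_positive0.
by rewrite mulrS; apply: e_positiveD.
Qed.

Lemma e_positive_sum (I : Type) (r : seq I) (F : I -> xseries) :
  (forall i, e_positive (F i)) -> e_positive (\sum_(i <- r) F i).
Proof.
move=> F_pos; elim/big_rec: _ => [|i f _]; first exact: e_positive0.
exact: e_positiveD.
Qed.

Lemma e_positive_seriesD f g :
  e_positive_series f -> e_positive_series g -> e_positive_series (f + g).
Proof. by move=> f_pos g_pos n; apply: e_positiveD. Qed.

Lemma e_positive_seriesM f g :
  e_positive_series f -> e_positive_series g -> e_positive_series (f * g).
Proof.
by move=> f_pos g_pos n; apply: e_positive_sum => i; apply: e_positiveM.
Qed.

Lemma e_positive_zsum m d a :
  (forall i, e_positive (a i)) -> e_positive_series (zsum m d a).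
Proof. by move=> a_pos n /=; case: ifP => // _; apply: e_positive0. Qed.

Lemma e_positive_ez k : e_positive_series (ez k).
Proof.
move=> n; rewrite zcoef_monom; apply: e_positiveMn; exact: e_positive_elem.
Qed.

Lemma e_positive_G k : e_positive_series (G_ge k).
Proof. by apply: e_positive_zsum => i; apply/e_positiveMn/e_positive_elem. Qed.

(* The inverse h of D = 1 - G satisfies h = 1 + G h, and G has no constant
   term. *)
Lemma e_positive_Dz_inv : e_positive_series Dz^-1.
Proof.
have hE : Dz^-1 = 1 + Gz * Dz^-1.
  rewrite -{1}(divrr Dz_unit) -mulrDl.
  by rewrite {1}/Dz addrNK mul1r.
move=> n; elim/ltn_ind: n => n IHn; rewrite hE zcoefD zcoef1.
apply: e_positiveD; first by apply: e_positiveMn; apply: e_positive1.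
apply: e_positive_sum => -[[|i] lt_i].
  by rewrite mul0r; apply: e_positive0.
apply: e_positiveM; first exact: e_positive_G.
by apply: IHn; rewrite ltn_subrL; case: (n) lt_i.
Qed.

Lemma e_positive_XP : e_positive_series XP.
Proof.
have -> : XP = Ez / Dz by rewrite -XP_Dz mulrK ?Dz_unit.
apply: e_positive_seriesM; last exact: e_positive_Dz_inv.
by apply: e_positive_zsum => i; apply: e_positive_elem.
Qed.

(** * The two expansions and their positivity *)

Lemma E_ge3_KG :
  zsum 3 0 elem_sym = zsum 3 0 (fun i => elem_sym i *+ i) - G_ge 3.
Proof.
apply: zseriesP => n; rewrite zcoefB !zcoef_sum0.
by case: n => [|[|[|n]]]; rewrite ?subr0 //= subSS subn0 mulrS addrK.
Qed.

(** K - G is the sum of the e_i z^i with i >= 2, as i - (i-1) = 1. *)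
Lemma EzE : Ez = Dz + ez 1 + Kz.
Proof.
have -> : Dz + ez 1 + Kz = 1 + ez 1 + Kz - Gz by rewrite /Dz; ring.
apply: zseriesP => n; rewrite zcoefB !zcoefD zcoef_monom !zcoef_sum0 zcoef1.
case: n => [|[|n]]; rewrite /= ?mulr0n ?mulr1n ?subr0 ?addr0 ?add0r //.
  exact: elem_sym0.
by rewrite subSS subn0 mulrS addrK.
Qed.

Theorem theorem3p14 :
  let S : zseries xseries :=
    (4^-1 : rat) *: zsum 3 2 (fun n => chromatic_sym (twinned_path n)) in
  let z : zseries xseries := zvar _ in
  let e (i : nat) : zseries xseries := zconst (elem_sym i) in
  [/\ S = (Kz + e 1%N * z * Gz) * (G_ge 3 ^+ 2 / Dz)
          + e 1%N * z * G_ge 3 ^+ 2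
          + (G_ge 3 * zsum 3 0 (fun i => elem_sym i *+ i)
             + e 1%N * z * zsum 4 0 (fun i => elem_sym i *+ (i - 1))
             + e 2%N * z ^+ 2 * zsum 3 0 (fun i => elem_sym i *+ (i - 2)))
          + zsum 5 0 (fun i => elem_sym i *+ i),
      S = XP * G_ge 3 ^+ 2
          + K_ge 5
          + G_ge 3 * zsum 3 0 elem_sym
          + e 1%N * z * G_ge 4
          + e 2%N * z ^+ 2 * zsum 3 0 (fun i => elem_sym i *+ (i - 2))
    & e_positive_series S].
Proof.
move=> S z e.
have -> : e 1%N * z = ez 1 by [].
have -> : e 2%N * z ^+ 2 = ez 2 by [].
have SE : S = XP * G_ge 3 ^+ 2 + K_ge 5 + G_ge 3 * zsum 3 0 elem_sym
     + ez 1 * G_ge 4 + ez 2 * zsum 3 0 (fun i => elem_sym i *+ (i - 2)).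
  by rewrite /S twinned_seriesE -scaler_nat scalerA mulVf // scale1r.
split=> //.
  (* The numerator D + e_1 z + K of X_P equals (1 + e_1 z) D + K + e_1 z G. *)
  have XPE' : XP = 1 + ez 1 + (Kz + ez 1 * Gz) / Dz.
    apply: (mulIr Dz_unit); rewrite XP_Dz EzE [RHS]mulrDl divrK ?Dz_unit //.
    by rewrite /Dz; ring.
  (* The [G_ge 3 ^+ 2] from the term 1 of [XPE'] cancels the one subtracted through [E_ge3_KG]. *)
  rewrite SE XPE' E_ge3_KG /K_ge -/(G_ge 4).
  ring.
(* Positivity is read off the second expansion, which is built from e-positive series by sums and
   products. *)
have zsum_pos m a : e_positive_series (zsum m 0 (fun i => elem_sym i *+ a i)).
  by apply: e_positive_zsum => i; apply/e_positiveMn/e_positive_elem.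
have E_pos : e_positive_series (zsum 3 0 elem_sym).
  by apply: e_positive_zsum => i; apply: e_positive_elem.
have G_pos := e_positive_G.
rewrite SE expr2; apply: e_positive_seriesD; last first.
  exact: e_positive_seriesM (e_positive_ez 2) (zsum_pos 3 (subn^~ 2)).
apply: e_positive_seriesD; last exact: e_positive_seriesM (e_positive_ez 1) _.
apply: e_positive_seriesD; last exact: e_positive_seriesM.
apply: e_positive_seriesD; last exact: zsum_pos.
apply: e_positive_seriesM; first exact: e_positive_XP.
exact: e_positive_seriesM.
Qed.
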